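(* Let $\mathcal{D}$ be the Boolean algebra (of subsets of $\omega$, with the usual set operations) \[\mathcal{D}=\Big\{A\subseteq\omega\colon\ \lim_{n\to\infty}\frac{|A\cap\{0,\ldots,n-1\}|}{n}\ \text{exists and belongs to}\ \{0,1\}\Big\},\] and let $St(\mathcal{D})$ be its Stone space. Then: (1) $St(\mathcal{D})$ does not have any non-trivial convergent sequences; (2) if $X\subseteq St(\mathcal{D})$ is infinite, then there exists an infinite subset $Y\subseteq X$ such that the closure $\overline{Y}^{St(\mathcal{D})}$ is homeomorphic to $\beta\omega$; (3) $St(\mathcal{D})$ carries a JN-sequence; (4) every JN-sequence $\langle\mu_n\colon n\in\omega\rangle$ on $St(\mathcal{D})$ has the property that $\lim_{n\to\infty}|\operatorname{supp}(\mu_n)|=\infty$.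
   Context: $\beta\omega$ is the Čech--Stone compactification of the discrete space $\omega$ of natural numbers. $C(X)$ is the set of all continuous functions $X\to\mathbb{R}$. A finitely supported (signed Borel) measure on $X$ is a finite linear combination $\mu=\sum_{x\in F}\alpha_x\delta_x$ of one-point (Dirac) measures, with $F\subseteq X$ finite and $\alpha_x\in\mathbb{R}\setminus\{0\}$ for $x\in F$; its support is $\operatorname{supp}(\mu)=F$, its norm is $\|\mu\|=\sum_{x\in F}|\alpha_x|$, and $\mu(f)=\int_X f\,d\mu=\sum_{x\in F}\alpha_xf(x)$. A JN-sequence on a Tychonoff space $X$ is a sequence $\langle\mu_n\colon n\in\omega\rangle$ of finitely supported signed measures on $X$ such that $\|\mu_n\|=1$ for every $n\in\omega$ and $\lim_{n\to\infty}\mu_n(f)=0$ for every $f\in C(X)$. *)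

(* Defs.v *)
From HB Require Import structures.
From mathcomp Require Import all_boot all_order all_algebra finmap.
From mathcomp Require Import boolp classical_sets functions cardinality filter.
From mathcomp Require Import reals topology normedtype sequences.

Set Implicit Arguments.
Unset Strict Implicit.
Unset Printing Implicit Defensive.

Import Order.TTheory GRing.Theory Num.Theory.
Import numFieldTopology.Exports numFieldNormedType.Exports.

Local Open Scope classical_set_scope.
Local Open Scope ring_scope.

Record set_algebra (T : Type) := SetAlgebra {
  alg_sets :> set T -> Prop;
  algT : alg_sets setT;
  algC : forall A, alg_sets A -> alg_sets (~` A);
  algI : setI_closed alg_sets }.

Record stone (T : Type) (B : set_algebra T) := Ultrafilter {
  uf_sets :> set T -> Prop;
  uf_sub : uf_sets `<=` B;
  ufT : uf_sets setT;
  uf0 : ~ uf_sets set0;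
  ufI : setI_closed uf_sets;
  ufS : forall A A', B A' -> A `<=` A' -> uf_sets A -> uf_sets A';
  uf_ultra : forall A, B A -> uf_sets A \/ uf_sets (~` A) }.

HB.instance Definition _ T (B : set_algebra T) := gen_eqMixin (stone B).
HB.instance Definition _ T (B : set_algebra T) := gen_choiceMixin (stone B).

Definition stone_clopen T (B : set_algebra T) (A : set T) : set (stone B) :=
  [set p : stone B | p A].
Arguments stone_clopen {T} B A.

Section StoneTopology.
Variables (T : Type) (B : set_algebra T).

Lemma stone_ext (p q : stone B) : (p : set_system T) = q -> p = q.
Proof.
case: p q => [p ? ? ? ? ? ?] [q ? ? ? ? ? ?] /= pq; subst q.
by congr Ultrafilter; apply: Prop_irrelevance.
Qed.

Lemma stone_clopen_cover : \bigcup_(A in B) stone_clopen B A = setT.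
Proof. by rewrite -subTset => p _; exists setT; [exact: algT|exact: ufT]. Qed.

Lemma stone_clopen_join A A' (p : stone B) : B A -> B A' ->
  stone_clopen B A p -> stone_clopen B A' p ->
  exists C, [/\ B C, stone_clopen B C p &
    stone_clopen B C `<=` stone_clopen B A `&` stone_clopen B A'].
Proof.
move=> BA BA' pA pA'; exists (A `&` A'); split.
- exact: algI.
- exact: (@ufI _ _ p).
- move=> q qAA'; split.
    by apply: (@ufS _ _ q (A `&` A')) => // x [].
  by apply: (@ufS _ _ q (A `&` A')) => // x [].
Qed.

HB.instance Definition _ := isBaseTopological.Build (stone B)
  stone_clopen_cover stone_clopen_join.

Lemma stone_open (A : set T) : B A -> open (stone_clopen B A).
Proof. by move=> BA; exists [set A]; [move=> _ -> | rewrite bigcup_set1]. Qed.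

Lemma stone_nbhs (p : stone B) (U : set (stone B)) :
  nbhs p U <-> exists A, p A /\ stone_clopen B A `<=` U.
Proof.
rewrite nbhsE; split.
  move=> [V [[D' D'B <-] [A D'A pA]] VU]; exists A; split=> // q qA.
  by apply: VU; exists A.
move=> [A [pA AU]]; exists (stone_clopen B A) => //; split=> //.
by apply: stone_open; exact: (@uf_sub _ _ p).
Qed.

Lemma stone_compact : compact [set: stone B].
Proof.
rewrite compact_ultra => F FU _.
have FF : ProperFilter F := ultra_proper.
pose P : set_system T := [set A | B A /\ F (stone_clopen B A)].
have P1 : P `<=` B by move=> A [].
have PT : P setT.
  split; first exact: algT.
  by apply: filterS filterT => p _; exact: ufT.
have P0 : ~ P set0.
  by move=> [_] /filter_ex[p] /uf0.
have PI : setI_closed P.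
  move=> A A' [BA FA] [BA' FA']; split; first exact: algI.
  by apply: filterS (filterI FA FA') => p [pA pA']; exact: (@ufI _ _ p).
have PS A A' : B A' -> A `<=` A' -> P A -> P A'.
  move=> BA' AA' [BA FA]; split=> //; apply: filterS FA => p.
  exact: (@ufS _ _ p).
have PU A : B A -> P A \/ P (~` A).
  move=> BA; have [FA|FA] := in_ultra_setVsetC (stone_clopen B A) FU.
    by left.
  right; split; first exact: algC.
  apply: filterS FA => p npA; by have [|//] := @uf_ultra _ _ p A BA.
exists (Ultrafilter P1 PT P0 PI PS PU); split=> //= U /stone_nbhs[A [[BA FA] AU]].
exact: filterS FA.
Qed.

Lemma stone_hausdorff : hausdorff_space (stone B).
Proof.
move=> p q pq; apply: stone_ext.
have sub (p' q' : stone B) : cluster (nbhs p') q' -> p' `<=` q'.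
  move=> c A pA; have BA := uf_sub pA.
  have [//|qA] := @uf_ultra _ _ q' A BA.
  have [||r [rA rA']] := c (stone_clopen B A) (stone_clopen B (~` A)).
  - by apply/stone_nbhs; exists A; split.
  - by apply/stone_nbhs; exists (~` A); split.
  - by have := @ufI _ _ r _ _ rA rA'; rewrite setICr => /uf0.
rewrite eqEsubset; split; apply: sub => //.
by move=> U V qU pV; rewrite setIC; exact: pq.
Qed.

End StoneTopology.

Definition homeomorphic (X Y : topologicalType) :=
  exists (f : X -> Y) (g : Y -> X),
    [/\ continuous f, continuous g, cancel f g & cancel g f].

Definition powerset_algebra (T : Type) : set_algebra T :=
  @SetAlgebra T setT I (fun _ _ => I) (fun _ _ _ _ => I).

(* The ultrafilter model; [cech_stone_beta_omega] below shows that it has the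
   defining properties of the Cech-Stone compactification of the topological
   space [nat], whose topology in the library is the discrete one. *)
Definition beta_omega : topologicalType := stone (powerset_algebra nat).

Definition is_embedding (X K : topologicalType) (e : X -> K) :=
  injective e /\
  forall U : set X, open U <-> exists2 V : set K, open V & e @^-1` V = U.

Definition is_cech_stone (X K : topologicalType) (e : X -> K) :=
  [/\ compact [set: K], hausdorff_space K, is_embedding e, dense (range e) &
    forall (L : topologicalType) (f : X -> L),
      compact [set: L] -> hausdorff_space L -> continuous f ->
      exists2 g : K -> L, continuous g & g \o e = f].

Section BetaOmega.

Definition beta_principal (n : nat) : beta_omega.
Proof.
exists [set A : set nat | A n] => //=.
- by move=> A A' _; exact.
- by move=> A _; have [An|nAn] := pselect (A n); [left|right].
Defined.

Lemma beta_ultra (p : beta_omega) : UltraFilter (p : set_system nat).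
Proof.
have pF : ProperFilter (p : set_system nat).
  split; first exact: uf0.
  split; [exact: ufT|exact: ufI|].
  by move=> A A' AA' pA; exact: (@ufS _ _ p A).
split=> // G GF pG; rewrite eqEsubset; split=> // A GA.
have [//|/pG GnA] := @uf_ultra _ _ p A I.
by case: (@filter_not_empty _ G GF); rewrite -(setICr A); exact: filterI.
Qed.

Lemma cech_stone_beta_omega : is_cech_stone beta_principal.
Proof.
split; [exact: stone_compact|exact: stone_hausdorff| | |].
- split=> [m n /(congr1 (fun p : beta_omega => p [set m]))/= mn|U].
    by apply/esym; rewrite -mn.
  split=> [_|_]; last exact: discrete_open.
  by exists (stone_clopen _ U) => //; exact: stone_open.
- move=> U [p Up] oU.
  have /stone_nbhs[A [pA AU]] : nbhs p U by exact: open_nbhs_nbhs.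
  have [n An] : A !=set0.
    by apply/set0P/eqP => A0; move: pA; rewrite A0 => /uf0.
  by exists (beta_principal n); split; [exact: AU|exists n].
- move=> L f cL hL _.
  have limP (p : beta_omega) : exists l : L, f @ (p : set_system nat) --> l.
    have pU := beta_ultra p; have pF : ProperFilter (p : set_system nat).
      exact: ultra_proper.
    have [l [_ lp]] := cL (f @ (p : set_system nat)) _ filterT.
    exists l => U lU.
    have [//|nU] := in_ultra_setVsetC (f @^-1` U) pU.
    have := lp (~` U) U nU lU; rewrite setICl => -[x []].
  have [g gP] := choice limP.
  have gE n : g (beta_principal n) = f n.
    apply: hL => U V gU fV.
    have Un : U (f n) by exact: (gP (beta_principal n) U gU).
    by exists (f n); split=> //; exact: nbhs_singleton.
  exists g; last by apply/funext => n /=.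
  move=> p U gpU.
  have := compact_regular (x := g p) hL cL filterT gpU.
  move=> [W /= gW WU].
  apply/stone_nbhs; exists (f @^-1` W); split; first exact: (gP p W gW).
  move=> q /= qW; apply: WU => V gqV.
  have pF : ProperFilter (q : set_system nat).
    by have qU := beta_ultra q; exact: ultra_proper.
  have [n [Wn Vn]] := filter_ex (filterI (qW : (q : set_system nat) (f @^-1` W)) (gP q V gqV)).
  by exists (f n).
Qed.

End BetaOmega.

(* At [n = 0] the quotient is [0 / 0 = 0]; this does not affect the limit. *)
Definition density_below (R : realType) (A : set nat) (n : nat) : R :=
  #|[pred k : 'I_n | (k : nat) \in A]|%:R / n%:R.

Definition density01 (R : realType) : set_system nat :=
  [set A | exists2 l : R, l \in [:: 0; 1] & density_below R A @ \oo --> l].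

Section Density01.
Variable R : realType.
Local Notation d := (density_below R).

Lemma density_below_ge0 A n : 0 <= d A n.
Proof. by rewrite divr_ge0. Qed.

Lemma density_below_le A A' n : A `<=` A' -> d A n <= d A' n.
Proof.
move=> AA'; rewrite ler_wpM2r ?invr_ge0// ler_nat subset_leq_card//.
by apply/fintype.subsetP => k; rewrite !inE => /AA'.
Qed.

Lemma density_belowC A n : (0 < n)%N -> d (~` A) n = 1 - d A n.
Proof.
move=> n0; have nu : (n%:R : R) != 0 by rewrite pnatr_eq0 -lt0n.
apply/eqP; rewrite -[1](divff nu) -mulrBl; apply/eqP; congr (_ / _).
apply/eqP; rewrite eq_sym subr_eq -natrD eqr_nat eq_sym addnC.
apply/eqP; rewrite -[RHS](card_ord n) -(cardC [pred k : 'I_n | (k : nat) \in A]).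
by congr (_ + _)%N; apply: eq_card => k; rewrite !inE in_setC.
Qed.

Lemma density_belowT n : (0 < n)%N -> d setT n = 1.
Proof.
move=> n0; have nu : (n%:R : R) != 0 by rewrite pnatr_eq0 -lt0n.
rewrite /density_below (_ : #|_| = n) ?divff//.
by rewrite -[RHS]card_ord; apply: eq_card => k; rewrite inE in_setT.
Qed.

Lemma density_belowI A A' n : (0 < n)%N -> d A n + d A' n - 1 <= d (A `&` A') n.
Proof.
move=> n0; have nu : (n%:R : R) != 0 by rewrite pnatr_eq0 -lt0n.
rewrite -[1](divff nu) -mulrDl -mulrBl ler_wpM2r ?invr_ge0// lerBlDr -!natrD.
rewrite ler_nat -cardUI addnC leq_add//; last first.
  by rewrite -[leqRHS](card_ord n) max_card.
by rewrite subset_leq_card//; apply/fintype.subsetP => k; rewrite -!topredE /= in_setI.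
Qed.

Lemma density01T : density01 R setT.
Proof.
exists 1; first by rewrite !inE eqxx orbT.
apply: cvg_near_cst; near=> n; apply/eqP; rewrite density_belowT//.
by near: n; exact: nbhs_infty_gt.
Unshelve. all: by end_near. Qed.

Lemma density01C A : density01 R A -> density01 R (~` A).
Proof.
move=> [l l01 dA]; exists (1 - l).
  move: l01; rewrite !inE => /orP[] /eqP ->.
    by rewrite subr0 eqxx orbT.
  by rewrite subrr eqxx.
have : (fun n => 1 - d A n) @ \oo --> 1 - l by apply: cvgB => //; exact: cvg_cst.
apply: cvg_trans; apply: near_eq_cvg; near=> n; rewrite density_belowC//.
by near: n; exact: nbhs_infty_gt.
Unshelve. all: by end_near. Qed.

Lemma density01I : setI_closed (density01 R).
Proof.
move=> A A' [l l01 dA] [l' l01' dA'].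
have null A0 A1 : A1 `<=` A0 -> d A0 @ \oo --> (0 : R) -> d A1 @ \oo --> (0 : R).
  move=> A10 dA0; apply: (@squeeze_cvgr _ _ _ _ (fun=> 0) (d A0)) => //.
    by near=> n; rewrite density_below_ge0 density_below_le.
  exact: cvg_cst.
have [l0|l1] : l = 0 \/ l = 1 by move: l01; rewrite !inE => /orP[] /eqP ->; [left|right].
  exists 0; first by rewrite !inE eqxx.
  by apply: (@null A); [move=> x []|rewrite -l0].
have [l0'|l1'] : l' = 0 \/ l' = 1 by move: l01'; rewrite !inE => /orP[] /eqP ->; [left|right].
  exists 0; first by rewrite !inE eqxx.
  by apply: (@null A'); [move=> x []|rewrite -l0'].
exists 1; first by rewrite !inE eqxx orbT.
rewrite l1 in dA; rewrite l1' in dA'.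
apply: (@squeeze_cvgr _ _ _ _ (fun n => d A n + d A' n - 1) (d A)) => //.
  near=> n; have n0 : (0 < n)%N by near: n; exact: nbhs_infty_gt.
  by rewrite density_belowI//= density_below_le// => x [].
rewrite -[X in _ --> X](addrK (1 : R)); apply: cvgB; last exact: cvg_cst.
exact: cvgD.
Unshelve. all: by end_near. Qed.

End Density01.

Definition density01_algebra (R : realType) : set_algebra nat :=
  SetAlgebra (density01T R) (@density01C R) (@density01I R).

Definition eventually_constant (T : Type) (u : nat -> T) :=
  exists x, \forall n \near \oo, u n = x.

Definition nontrivial_convergent (X : topologicalType) (u : nat -> X) :=
  (exists x : X, u @ \oo --> x) /\ ~ eventually_constant u.

(* A finitely supported signed measure is encoded by its coefficient function:
   [mu] is the linear combination of Dirac measures with coefficient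
   [mu x], nonzero exactly for [x] in the finite set [finsupp mu]. *)
Definition fs_measure (R : realType) (X : topologicalType) :=
  {fsfun X -> R with 0}.

(* The norm is the total variation, and integration against a combination of
   Dirac measures is the corresponding finite sum of values. *)
Definition fs_norm (R : realType) (X : topologicalType)
    (mu : fs_measure R X) : R :=
  \sum_(x <- finsupp mu) `|mu x|.

Definition fs_integral (R : realType) (X : topologicalType)
    (mu : fs_measure R X) (f : X -> R) : R :=
  \sum_(x <- finsupp mu) mu x * f x.

Definition JN_sequence (R : realType) (X : topologicalType)
    (mu : nat -> fs_measure R X) :=
  (forall n, fs_norm (mu n) = 1) /\
  (forall f : X -> R, continuous f ->
    (fun n => fs_integral (mu n) f) @ \oo --> (0 : R)).

(* Main.v *)
Require Import Defs.
From HB Require Import structures.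
From mathcomp Require Import all_boot all_order all_algebra finmap.
From mathcomp Require Import boolp classical_sets functions cardinality filter.
From mathcomp Require Import reals topology normedtype sequences.
From mathcomp Require Import ring lra.

Set Implicit Arguments.
Unset Strict Implicit.
Unset Printing Implicit Defensive.

Import Order.TTheory GRing.Theory Num.Theory.
Import numFieldTopology.Exports numFieldNormedType.Exports.

Local Open Scope classical_set_scope.
Local Open Scope ring_scope.

(* Apart from the ultrafilter of sets of density 1 and finitely many principal
   ones, every ultrafilter on the algebra contains a set of density 0 all of
   whose relative densities are at most a given epsilon. Hence every infinite
   set of ultrafilters contains a sequence [y n] separated by disjoint sets
   [A n] with relative densities at most [2 ^- n.+1]; their union has density 0,
   so the algebra contains all its subsets. This makes the closure of [y] a copy
   of beta omega and excludes convergent sequences. Since a continuous function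
   converges along [nat] to its value at the ultrafilter of sets of density 1
   outside sets of small density, the difference of the Dirac measure there and
   the averages of the principal ones is, up to the factor 1/2, a JN-sequence.
   If infinitely many measures of a JN-sequence had supports of size at most M,
   then for each epsilon only finitely many points could carry mass at least
   epsilon: otherwise the separated sequence found among them can be thinned out
   so that a single clopen set meets infinitely many of the supports in exactly
   one such point. Isolating each of these finitely many points from the others
   by a clopen set shows that their masses are eventually of order M * epsilon,
   so that the norms cannot be 1. *)

(** * Infinite index sets and their thinning *)

Lemma infinite_near (T : set nat) (P : nat -> Prop) :
  infinite_set T -> (\forall n \near \oo, P n) -> exists2 n, T n & P n.
Proof.
move=> Tinf [N _ NP].
have [n [Tn nN]] := infinite_setN0 (infinite_setD Tinf (finite_II N)).
by exists n => //; apply: NP; rewrite /= leqNgt; apply/negP.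
Qed.

Lemma finite_near (T : set nat) : finite_set T -> \forall n \near \oo, ~ T n.
Proof.
move=> /finite_seqP[s ->]; exists (\max_(i <- s) i).+1 => // n /= sn ns.
by move: sn; rewrite ltnNge leq_bigmax_seq.
Qed.

Lemma infinite_injection (T : pointedType) (A : set T) : infinite_set A ->
  exists2 f : nat -> T, injective f & range f `<=` A.
Proof.
move=> /infiniteP/pcard_leP[f]; exists f; last first.
  by move=> _ [n _ <-]; exact: funS.
by move=> m n fmn; apply: (@inj _ _ setT f); rewrite ?in_setT.
Qed.

Lemma infinite_range (T : Type) (f : nat -> T) :
  injective f -> infinite_set (range f).
Proof.
move=> fi fin; apply: infinite_nat; rewrite -(preimage_range f).
by apply: finite_preimage => // m n _ _; exact: fi.
Qed.

(* Split [T] into infinitely many infinite pieces. If no piece can serve as [S],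
   pick in every piece a bad index [k]: the picked indices form an infinite set
   on which [m] is smaller, since it misses a point of [P k] that lies in the
   rest of the piece of [k]. *)
Lemma disjoint_thinning (X : choiceType) (h : set nat -> set X)
    (P : nat -> {fset X}) (m : nat) (T : set nat) :
  (forall S S', S `<=` S' -> h S `<=` h S') ->
  (forall S S', S `&` S' = set0 -> h S `&` h S' = set0) ->
  infinite_set T ->
  (forall k, T k -> (#|` [fset x in P k | `[< h T x >]]%fset| <= m)%N) ->
  exists S, [/\ S `<=` T, infinite_set S &
    forall k x, S k -> x \in P k -> ~ h (S `\ k) x].
Proof.
move=> hS hI; elim: m T => [|m IH] T Tinf Tm.
  exists T; split=> // k x Tk xP hx; have := Tm k Tk.
  rewrite leqn0 cardfs_eq0 => /eqP/fsetP/(_ x); rewrite !inE /= xP /=.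
  by move/negP; apply; apply/asboolP; apply: hS hx => i [].
have [f fi fT] := infinite_injection Tinf.
(* [choice.pickle] codes pairs injectively, so the pieces [Q j] are infinite and pairwise
   disjoint. *)
pose Q (j : nat) : set nat := range (fun n : nat => f (choice.pickle (j, n))).
have QT j : Q j `<=` T by move=> _ [n _ <-]; apply: fT; exists (choice.pickle (j, n)).
have Qinf j : infinite_set (Q j).
  by apply: infinite_range => a b /fi /(pcan_inj choice.pickleK) [].
have Qj i j k : Q i k -> Q j k -> i = j.
  by move=> [a _ <-] [b _ /fi /(pcan_inj choice.pickleK) []].
have [[j jgood]|bad] := pselect (exists j, forall k x, Q j k -> x \in P k -> ~ h (Q j `\ k) x).
  by exists (Q j).
have /choice[g gP] : forall j, exists kx : nat * X,
    [/\ Q j kx.1, kx.2 \in P kx.1 & h (Q j `\ kx.1) kx.2].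
  move=> j; apply: contrapT => nj; apply: bad; exists j => k x Qk xP hx.
  by apply: nj; exists (k, x).
have gT : range (fst \o g) `<=` T.
  by move=> _ [j _ <-]; have [+ _ _] := gP j; exact: QT.
have [||S [ST Sinf SP]] := IH (range (fst \o g)).
- apply: infinite_range => i j /= gij; have [gi _ _] := gP i.
  by have [gj _ _] := gP j; apply: Qj gi _; rewrite gij.
- move=> _ [j _ <-] /=; have [gQ gp gh] := gP j.
  rewrite -ltnS (leq_trans _ (Tm _ (QT _ _ gQ)))//; apply: fproper_ltn_card.
  rewrite fproperE; apply/andP; split.
    apply/fsubsetP => x; rewrite !inE /= => /andP[-> /asboolP hx].
    by apply/asboolP; exact: hS hx.
  apply/fsubsetPn; exists (g j).2; rewrite !inE /= gp /=.
    by apply/asboolP; apply: hS gh => i [] /QT.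
  apply/negP => /asboolP hx.
  (* The only picked index that lies in [Q j] is [(g j).1]. *)
  have dis : (Q j `\ (g j).1) `&` range (fst \o g) = set0.
    rewrite -subset0 => k /= [[Qk kj] [i _ ik]]; apply: kj.
    have [gi _ _] := gP i; rewrite ik in gi.
    by rewrite -ik (Qj _ _ _ gi Qk).
  by have [] : set0 (g j).2 by rewrite -(hI _ _ dis).
- exists S; split=> //; exact: subset_trans gT.
Qed.

(** * Ultrafilters on an algebra of sets *)

Section StoneSpace.
Variables (T : Type) (B : set_algebra T).
Implicit Types (p q : stone B) (A E : set T).

Lemma uf_setI_neq0 p A E : p A -> p E -> A `&` E !=set0.
Proof.
move=> pA pE; apply/set0P/eqP => AE0; apply: (@uf0 _ _ p).
by rewrite -AE0; exact: ufI.
Qed.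

Lemma uf_setC p A : B A -> ~ p A -> p (~` A).
Proof. by move=> BA npA; have [] := uf_ultra p BA. Qed.

Lemma uf_setCN p A : p (~` A) -> ~ p A.
Proof. by move=> pA pA'; have [x []] := uf_setI_neq0 pA pA'. Qed.

Lemma uf_setU p A E : B A -> B E -> p (A `|` E) -> p A \/ p E.
Proof.
move=> BA BE pAE; apply: contrapT => /not_orP[/(uf_setC BA) pA /(uf_setC BE) pE].
by have [x [[]]] := uf_setI_neq0 pAE (ufI pA pE); move=> ? [].
Qed.

Lemma uf_sub_eq p q : p `<=` q -> p = q.
Proof.
move=> pq; apply: stone_ext; rewrite eqEsubset; split=> // A qA.
by apply: contrapT => /(uf_setC (uf_sub qA)) /pq /uf_setCN.
Qed.

Lemma stone_separate p q : p <> q -> exists2 A, p A & ~ q A.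
Proof.
move=> pq; apply: contrapT => npq; apply: pq; apply: uf_sub_eq => A pA.
by apply: contrapT => qA; apply: npq; exists A.
Qed.

Lemma stone_separate_seq p (s : seq (stone B)) :
  exists2 A, p A & forall q, q \in s -> q <> p -> ~ q A.
Proof.
elim: s => [|r s [A pA sA]]; first by exists setT => //; exact: ufT.
have [->|/eqP rp] := eqVneq r p.
  by exists A => // q; rewrite inE => /predU1P[->|qs] //; exact: sA.
have [E pE rE] := stone_separate (nesym rp); exists (A `&` E); first exact: ufI.
have BA := uf_sub pA; have BE := uf_sub pE.
move=> q; rewrite inE => /predU1P[->|qs] qp qAE.
  by apply: rE; apply: ufS qAE => // x [].
by apply: (sA q qs qp); apply: ufS qAE => // x [].
Qed.

Definition stone_principal (k : T) : stone B.
Proof.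
exists [set A | B A /\ A k].
- by move=> A [].
- by split; [exact: algT|].
- by case.
- by move=> A E [BA Ak] [BE Ek]; split=> //; exact: algI.
- by move=> A E BE AE [BA Ak]; split=> //; exact: AE.
- move=> A BA; have [Ak|Ak] := pselect (A k); first by left.
  by right; split=> //; exact: algC.
Defined.

Lemma stone_principalP p k : p [set k] -> p = stone_principal k.
Proof.
move=> pk; apply/esym/uf_sub_eq => A [BA Ak].
by apply: ufS pk => // x ->.
Qed.

(** The characteristic function of the clopen set given by [A]: the test function against which
    arbitrary JN-sequences are evaluated. *)
Definition stone_indic (R : realType) A : stone B -> R := fun p => `[< p A >]%:R.

Lemma stone_indic_continuous (R : realType) A :
  B A -> continuous (stone_indic R A).
Proof.
move=> BA p.
suff [E [pE EA]] : exists E, p E /\ forall q, q E -> stone_indic R A q = stone_indic R A p.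
  move=> V /nbhs_singleton Vp; apply/stone_nbhs; exists E; split=> // q qE.
  by rewrite /= EA.
have [pA|pA] := uf_ultra p BA.
  by exists A; split=> // q qA; rewrite /stone_indic !asboolT.
exists (~` A); split=> // q qA.
by rewrite /stone_indic !asboolF//; exact: uf_setCN.
Qed.

End StoneSpace.

(* The last clause asks for all subsets of the union, not only for the unions of
   subfamilies of [A], so that the [A n] may later be shrunk arbitrarily. *)
Definition separated_by (T : Type) (B : set_algebra T) (y : nat -> stone B) (A : nat -> set T) :=
  [/\ forall n, y n (A n), trivIset setT A &
      forall E, E `<=` \bigcup_n A n -> B E].

(** * Separated sequences: closure and divergence *)

Section Separated.
Variables (T : Type) (B : set_algebra T).
Implicit Types (p : stone B) (E : set T).
Variables (y : nat -> stone B) (A : nat -> set T).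
Hypothesis yA : separated_by y A.
Local Notation U S := (\bigcup_(n in S) A n).

Lemma separated_alg (S : set nat) : B (U S).
Proof. by have [_ _] := yA; apply; exact: bigcup_subset. Qed.

Lemma separated_disjoint p (S S' : set nat) :
  p (U S) -> p (U S') -> S `&` S' !=set0.
Proof.
move=> pS pS'; have [x [[n Sn An] [m Sm Am]]] := uf_setI_neq0 pS pS'.
have [_ /trivIsetP tA _] := yA; exists n; split=> //.
have [->//|nm] := eqVneq n m.
by have := tA n m I I nm; rewrite -subset0 => /(_ x); case.
Qed.

Lemma separated_mem n (S : set nat) : y n (U S) <-> S n.
Proof.
have [yAn _ _] := yA.
have ynU (S' : set nat) : S' n -> y n (U S').
  move=> Sn; apply: (@ufS _ _ _ (A n)) => //; first exact: separated_alg.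
  by move=> x Ax; exists n.
split=> [yS|]; last exact: ynU.
by have [m [/= -> ]] := separated_disjoint (ynU [set n] erefl) yS.
Qed.

Lemma separated_inj : injective y.
Proof.
move=> m n ymn; have /separated_mem -> // : y m (U [set n]).
by rewrite ymn; apply/separated_mem.
Qed.

(** The limit of [y] along [q]; as [q] varies this is the continuous extension of [y] to
    [beta_omega]. *)
Definition beta_lift (q : beta_omega) : stone B.
Proof.
exists [set E | B E /\ q [set n | y n E]].
- by move=> E [].
- split; first exact: algT.
  by apply: ufS (ufT q) => // n _; exact: ufT.
- by move=> [_]; apply: contra_not (@uf0 _ _ q); apply: ufS => // n /uf0.
- move=> E F [BE qE] [BF qF]; split; first exact: algI.
  by apply: ufS (ufI qE qF) => // n [yE yF]; exact: ufI.
- move=> E F BF EF [BE qE]; split=> //; apply: ufS qE => // n.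
  exact: ufS.
- move=> E BE; have [qE|qE] := @uf_ultra _ _ q [set n | y n E] I; first by left.
  right; split; first exact: algC.
  by apply: ufS qE => // n /(uf_setC BE).
Defined.

Lemma beta_liftE (q : beta_omega) E : beta_lift q E = (B E /\ q [set n | y n E]).
Proof. by []. Qed.

(** The inverse of [beta_lift] on the closure of [range y]. The hypothesis [pU] puts [setT] into the
    trace. *)
Definition beta_trace p (pU : p (U setT)) : beta_omega.
Proof.
exists [set S | p (U S)] => //.
- by move=> /separated_disjoint/(_ pU) [n []].
- move=> S S' pS pS'; apply: ufS (ufI pS pS'); first exact: separated_alg.
  move=> x [[n Sn An] [m Sm Am]]; exists n => //; split=> //.
  have [_ /trivIsetP tA _] := yA; have [->//|nm] := eqVneq n m.
  by have := tA n m I I nm; rewrite -subset0 => /(_ x); case.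
- move=> S S' _ SS'; apply: ufS; first exact: separated_alg.
  exact: bigcup_subset.
- move=> S _; apply: uf_setU; try exact: separated_alg.
  by rewrite -bigcup_setU setUv.
Defined.

Lemma beta_lift_closure (q : beta_omega) : closure (range y) (beta_lift q).
Proof.
move=> V /stone_nbhs[E []]; rewrite beta_liftE => -[BE qE] EV.
have [n [/= yE _]] := uf_setI_neq0 qE (ufT q).
by exists (y n); split; [exists n|exact: EV].
Qed.

(** The intersection of [U S] and [E] gives a neighbourhood of [p], and a term [y n] in it has its
    index in [S]. *)
Lemma closure_separated p (S : set nat) E : closure (range y) p ->
  p (U S) -> p E -> exists2 n, S n & y n E.
Proof.
move=> cp pS pE.
have /cp [_ [[n _ <-] ySE]] : nbhs p (stone_clopen B (U S `&` E)).
  by apply/stone_nbhs; exists (U S `&` E); split=> //; exact: ufI.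
have BE := uf_sub pE.
exists n; last by apply: ufS ySE => // x [].
by apply/separated_mem; apply: ufS ySE; [exact: separated_alg|move=> x []].
Qed.

Lemma closure_separatedT p : closure (range y) p -> p (U setT).
Proof.
move=> cp; apply: contrapT => /(uf_setC (separated_alg _)) pU.
have /cp [_ [[n _ <-] /uf_setCN]] : nbhs p (stone_clopen B (~` (U setT))).
  by apply/stone_nbhs; exists (~` (U setT)); split.
by apply; apply/separated_mem.
Qed.

Lemma beta_traceK p (pU : p (U setT)) :
  closure (range y) p -> beta_lift (beta_trace pU) = p.
Proof.
move=> cp; apply: uf_sub_eq => E [BE /= pE]; apply: contrapT => /(uf_setC BE) pE'.
by have [n /= yE /uf_setCN] := closure_separated cp pE pE'.
Qed.

Lemma beta_liftK (q : beta_omega) (qU : beta_lift q (U setT)) : beta_trace qU = q.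
Proof.
apply: uf_sub_eq => S [BS /= qS].
by rewrite (_ : S = [set n | y n (U S)])//; rewrite eqEsubset; split=> n /separated_mem.
Qed.

Lemma closure_separated_beta : homeomorphic (closure (range y)) beta_omega.
Proof.
pose f (p : closure (range y)) : beta_omega :=
  beta_trace (closure_separatedT (set_valP p)).
pose g (q : beta_omega) : closure (range y) := SigSub (mem_set (@beta_lift_closure q)).
exists f, g; split.
- move=> p V /stone_nbhs[S [pS SV]].
  have pS' : nbhs p (set_val @^-1` stone_clopen B (U S)).
    apply: (@initial_continuous _ _ (set_val : closure (range y) -> stone B) p).
    by apply/stone_nbhs; exists (U S); split.
  by apply: (@filterS _ (nbhs p) _ _ _ _ pS') => p' ?; exact: SV.
- apply: continuous_comp_initial => q V /stone_nbhs[E [[BE qE] EV]].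
  apply/stone_nbhs; exists [set n | y n E]; split=> // q' q'E.
  by apply: EV; split.
- move=> p; apply: val_inj; rewrite /= beta_traceK//; exact: set_valP.
- move=> q; rewrite /f /g /=; exact: beta_liftK.
Qed.

(** Split the indices into even and odd ones. Infinitely often [u] is in the clopen set of either
    half, so a limit [p] contains neither union; but then [p] contains the complement of [U setT],
    whose clopen set [u] leaves infinitely often. *)
Lemma separated_not_cvg (u : nat -> stone B) p :
  (forall n, range u (y n)) -> ~ u @ \oo --> p.
Proof.
move=> yu up.
have inf (S : set nat) : infinite_set S -> infinite_set [set k | u k (U S)].
  move=> Sinf; apply: contra_not Sinf => fin.
  have -> : S = y @^-1` [set u k | k in [set k | u k (U S)]].
    rewrite eqEsubset; split=> n /=.
      have [k _ uk] := yu n; move=> /separated_mem ySn; exists k => //=.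
      by rewrite uk.
    by move=> [k + ukn]; rewrite ukn => /separated_mem.
  apply: finite_preimage; last exact: finite_image.
  by move=> m n _ _; exact: separated_inj.
have frq (S S' : set nat) : infinite_set S -> S `&` S' = set0 -> ~ p (U S').
  move=> Sinf SS' pS'.
  have /up /(infinite_near (inf S Sinf))[k ukS ukS'] :
      nbhs p (stone_clopen B (U S')).
    by apply/stone_nbhs; exists (U S'); split.
  by have := separated_disjoint ukS ukS'; rewrite SS' => -[].
pose S : set nat := range double.
have Sinf : infinite_set S by apply: infinite_range; exact: double_inj.
have Sinf' : infinite_set (~` S).
  apply: (@sub_infinite_set _ (range (fun n => n.*2.+1))).
    by move=> _ [n _ <-] [m _ /(congr1 odd)]; rewrite /= !odd_double.
  by apply: infinite_range => m n [] /double_inj.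
have pS' := frq S (~` S) Sinf (setICr _).
have pS := frq (~` S) S Sinf' (setICl _).
have pT : ~ p (U setT).
  rewrite -(setUv S) bigcup_setU.
  by move=> /(uf_setU (separated_alg _) (separated_alg _))[].
have /up /(infinite_near (inf S Sinf))[k ukS] :
    nbhs p (stone_clopen B (~` (U setT))).
  apply/stone_nbhs; exists (~` (U setT)); split=> //.
  by apply: uf_setC => //; exact: separated_alg.
move=> /uf_setCN; apply; apply: ufS ukS; first exact: separated_alg.
exact: bigcup_subset.
Qed.

End Separated.

(** * JN-sequences and the size of their supports *)

Lemma sum_le_size (R : realType) (X : eqType) (s : seq X) (P : pred X)
    (f : X -> R) (c : R) : 0 <= c ->
  (forall x, x \in s -> P x -> f x <= c) ->
  \sum_(x <- s | P x) f x <= c *+ size s.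
Proof.
move=> c0; elim: s => [|x s IH] fc; first by rewrite big_nil.
have {}IH : \sum_(x <- s | P x) f x <= c *+ size s.
  by apply: IH => z zs; apply: fc; rewrite inE zs orbT.
rewrite big_cons /= mulrS; case: ifPn => Px; last by rewrite (le_trans IH)// lerDr.
by rewrite lerD// fc// mem_head.
Qed.

Lemma near_seq (X : eqType) (s : seq X) (P : X -> nat -> Prop) :
  (forall x, \forall n \near \oo, P x n) ->
  \forall n \near \oo, forall x, x \in s -> P x n.
Proof.
move=> nP; elim: s => [|x s IH]; first by near=> n.
near=> n => z; rewrite inE => /predU1P[->|].
  by near: n; exact: nP.
by move: z; near: n.
Unshelve. all: by end_near. Qed.

Section BoundedSupport.
Variables (R : realType) (T : Type) (B : set_algebra T).
Implicit Types (m : fs_measure R (stone B)).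

Lemma fs_integral_indicE m A (x : stone B) : x \in finsupp m -> x A ->
  fs_integral m (stone_indic R A) =
  m x + \sum_(z <- finsupp m | (z != x) && `[< (z : stone B) A >]) m z.
Proof.
move=> xm xA; rewrite big_mkcondr /fs_integral (bigD1_seq x xm (fset_uniq _)) /=.
rewrite {1}/stone_indic asboolT// mulr1; congr (_ + _).
apply: eq_bigr => z _; rewrite /stone_indic.
by case: asboolP => _; rewrite ?mulr1 ?mulr0.
Qed.

(** What the argument uses of the algebra; [density_separated] supplies it for
    [density01_algebra]. *)
Hypothesis separable : forall X : set (stone B), infinite_set X ->
  exists y A, (forall n, X (y n)) /\ separated_by y A.
Variable mu : nat -> fs_measure R (stone B).
Hypothesis mu_JN : JN_sequence mu.

Lemma JN_clopen A : B A ->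
  (fun n => fs_integral (mu n) (stone_indic R A)) @ \oo --> (0 : R).
Proof. by move=> BA; apply: mu_JN.2; exact: stone_indic_continuous. Qed.

Lemma JN_large_finite (S : set nat) M (eps : R) : 0 < eps ->
  (forall n, S n -> (#|` finsupp (mu n)| <= M)%N) ->
  finite_set [set x | exists2 n, S n & eps <= `|mu n x|].
Proof.
move=> eps0 SM; apply: contrapT => /separable[y [A [yE yA]]].
have /choice[n nP] : forall k, exists n, S n /\ eps <= `|mu n (y k)|.
  by move=> k; have [n Sn ny] := yE k; exists n.
(* [C k] separates [y k] from the rest of the support of [mu (n k)], so [A k] can be shrunk to avoid
   these other points. *)
have /choice[C CP] : forall k, exists C, y k C /\
    forall q, q \in finsupp (mu (n k)) -> q <> y k -> ~ q C.
  move=> k; have [C yC CP] := stone_separate_seq (y k) (finsupp (mu (n k))).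
  by exists C.
have [yAn tA subA] := yA.
have yAC : separated_by y (fun k => A k `&` C k).
  split.
  - by move=> k; apply: ufI => //; exact: (CP k).1.
  - apply/trivIsetP => i j _ _ ij; rewrite setIACA.
    by move/trivIsetP : tA => -> //; rewrite set0I.
  - by move=> E EAC; apply: subA => x /EAC[k _ [Akx _]]; exists k.
pose U (K : set nat) := \bigcup_(k in K) (A k `&` C k).
have BU K : B (U K) by exact: separated_alg yAC _.
(* Thinning makes the sets with indices in [K] other than [k] miss the support of [mu (n k)].
   Together with the choice of [C k], only [y k] then contributes to the integral over [U K]. *)
have [||||K [_ Kinf KP]] := @disjoint_thinning (stone B) (fun K x => x (U K))
    (fun k => finsupp (mu (n k))) M setT.
- by move=> K K' KK' x; apply: ufS => //; exact: bigcup_subset.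
- move=> K K' KK'; rewrite -subset0 => x [xK xK'].
  by have := separated_disjoint yAC xK xK'; rewrite KK' => -[].
- exact: infinite_nat.
- move=> k _; apply: leq_trans (SM _ (nP k).1).
  by apply: fsubset_leq_card; apply/fsubsetP => x; rewrite !inE => /andP[].
have ym k : y k \in finsupp (mu (n k)).
  rewrite mem_finsupp; apply: contraTneq (nP k).2 => ->.
  by rewrite normr0 -ltNge.
have muK k : K k -> fs_integral (mu (n k)) (stone_indic R (U K)) = mu (n k) (y k).
  move=> Kk; rewrite (fs_integral_indicE (ym k) ((separated_mem yAC k K).2 Kk)).
  rewrite big1_seq ?addr0// => z /andP[/andP[/eqP zy /asboolP + zm]].
  rewrite -(setD1K Kk) /U bigcup_setU bigcup_set1.
  move=> /uf_setU[]; [exact: (uf_sub (ufI (yAn k) (CP k).1))|exact: BU| |].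
    move=> zAC; case: ((CP k).2 z zm zy).
    by apply: ufS zAC => [|x []//]; exact: uf_sub (CP k).1.
  by move/KP => /(_ Kk zm).
(* [n] need not be injective, but one finite support contains only finitely many of the distinct
   points [y k]. *)
have ninf : infinite_set (n @` K).
  apply: contra_not Kinf => nK; apply: (@sub_finite_set _ _
      (\bigcup_(i in n @` K) (y @^-1` [set` finsupp (mu i)]))).
    by move=> k Kk; exists (n k); [exists k|exact: ym].
  apply: bigcup_finite => // i _; apply: finite_preimage; last exact: finite_fset.
  by move=> j k _ _ /(separated_inj yAC).
have /cvgr0Pnorm_lt/(_ _ eps0) := JN_clopen (BU K).
move=> /(infinite_near ninf)[_ [k Kk <-]]; rewrite muK// ltNge.
by rewrite (nP k).2.
Qed.

Lemma JN_support_unbounded : (fun n => #|` finsupp (mu n)|) @ \oo --> \oo.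
Proof.
apply/cvgnyPge => M; apply: contrapT => MN.
pose S := [set n | (#|` finsupp (mu n)| <= M)%N].
have Sinf : infinite_set S.
  apply: contra_not MN => /finite_near; apply: filterS => n /negP.
  by rewrite -ltnNge => /ltnW.
pose c : R := M.+1%:R; have c1 : 1 <= c by rewrite ler1n.
(* Each mass will be at most [c * eps], so the norm is at most [c ^+ 2 * eps], which is 1/2. *)
pose eps : R := (2 * c ^+ 2)^-1.
have eps0 : 0 < eps by rewrite invr_gt0 mulr_gt0// exprn_gt0// (lt_le_trans ltr01).
have /finite_seqP[s sE] := JN_large_finite (S := S) eps0 (fun n => id).
have /choice[C CP] : forall x : stone B, exists C, x C /\
    forall q, q \in s -> q <> x -> ~ q C.
  by move=> x; have [C xC CP] := stone_separate_seq x s; exists C.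
have /(near_seq s) : forall x, \forall n \near \oo,
    `|fs_integral (mu n) (stone_indic R (C x))| < eps.
  by move=> x; have /cvgr0Pnorm_lt/(_ _ eps0) := JN_clopen (uf_sub (CP x).1).
move=> /(infinite_near Sinf)[n Sn nC].
have small x : x \notin s -> `|mu n x| <= eps.
  move=> xs; rewrite leNgt; apply: contra xs => /ltW xeps.
  suff : [set` s] x by [].
  by rewrite -sE; exists n.
have sM (f : stone B -> R) (P : pred (stone B)) (a : R) : 0 <= a ->
    (forall x, P x -> f x <= a) -> \sum_(x <- finsupp (mu n) | P x) f x <= M%:R * a.
  move=> a0 fa; apply: le_trans (sum_le_size a0 _) _; first by move=> x _; exact: fa.
  by rewrite -[_ *+ size _]mulr_natl ler_wpM2r// ler_nat.
(* For [x] in [s], the clopen set of [C x] contains no other point of [s], so the other support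
   points in it, at most [M] in number, have mass at most [eps] each. *)
have bound x : `|mu n x| <= c * eps.
  have [xs|xs] := boolP (x \in s); last first.
    by rewrite (le_trans (small x xs))// ler_peMl// ltW.
  have [xm|xm] := boolP (x \in finsupp (mu n)); last first.
    by rewrite fsfun_dflt// normr0 mulr_ge0// ltW.
  have := nC x xs; rewrite (fs_integral_indicE xm (CP x).1).
  set r := \sum_(_ <- _ | _) _ => xr.
  have rM : `|r| <= M%:R * eps.
    apply: le_trans (ler_norm_sum _ _ _) _; apply: sM; first exact: ltW.
    move=> z /andP[/eqP zx /asboolP zC]; apply: small; apply/negP => zs.
    exact: (CP x).2 zs zx zC.
  rewrite -[mu n x](addrK r) (le_trans (ler_normB _ _))//.
  by rewrite /c -natr1 mulrDl mul1r addrC lerD// ltW.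
have := mu_JN.1 n; rewrite /fs_norm => /eqP; apply/negP; rewrite lt_eqF//.
apply: le_lt_trans (sM _ predT _ _ (fun x _ => bound x)) _.
  by rewrite mulr_ge0// ltW.
apply: (@le_lt_trans _ _ (c * (c * eps))).
  by rewrite ler_wpM2r ?mulr_ge0 ?ler_nat// ltW.
rewrite mulrA -expr2 /eps invfM mulrCA divff ?mulr1 ?invf_lt1 ?ltr1n//.
by rewrite expf_neq0// gt_eqF// (lt_le_trans ltr01).
Qed.

End BoundedSupport.

(** * Sets of density zero and small ultrafilters *)

Section Density.
Variable R : realType.
Local Notation d := (density_below R).
Local Notation D := (density01_algebra R).
Implicit Types (A E : set nat) (p : stone D).

Definition null A := d A @ \oo --> (0 : R).

(** Asking for the inclusion only below [n] allows initial segments to be ignored or cut off. *)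
Lemma density_below_leq A E n : (forall k, (k < n)%N -> A k -> E k) ->
  d A n <= d E n.
Proof.
move=> AE; rewrite ler_wpM2r ?invr_ge0// ler_nat subset_leq_card//.
apply/fintype.subsetP => k; rewrite -!topredE /= !in_setE.
exact: AE.
Qed.

Lemma density_below_setU A E n : d (A `|` E) n <= d A n + d E n.
Proof.
rewrite -mulrDl ler_wpM2r ?invr_ge0// -natrD ler_nat -cardUI -[leqLHS]addn0.
rewrite leq_add// subset_leq_card//; apply/fintype.subsetP => k.
by rewrite -!topredE /= in_setU.
Qed.

Lemma density_below_ge A k n : (k < n)%N -> A k -> n%:R^-1 <= d A n.
Proof.
move=> kn Ak; rewrite -[leLHS]mul1r ler_wpM2r ?invr_ge0// ler1n.
by apply/card_gt0P; exists (Ordinal kn); rewrite -topredE /= in_setE.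
Qed.

Lemma density_below_set0 n : d set0 n = 0.
Proof.
rewrite /density_below (_ : #|_| = 0)%N ?mul0r// eq_card0// => k.
by rewrite -topredE /= in_set0.
Qed.

Lemma density_below_set1 k n : d [set k] n <= n%:R^-1.
Proof.
rewrite -[leRHS]mul1r ler_wpM2r ?invr_ge0// lern1.
apply/card_le1_eqP => i j; rewrite -!topredE /= !in_setE /= => ik jk.
by apply: val_inj; rewrite /= ik jk.
Qed.

Lemma null_sub A E : A `<=` E -> null E -> null A.
Proof.
move=> AE nE; apply: (@squeeze_cvgr _ _ _ _ (fun=> 0) (d E)) nE.
  by near=> n; rewrite density_below_ge0 density_below_le.
exact: cvg_cst.
Unshelve. all: by end_near. Qed.

Lemma null_alg A : null A -> D A.
Proof. by move=> nA; exists 0 => //; rewrite mem_head. Qed.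

Lemma null_setU A E : null A -> null E -> null (A `|` E).
Proof.
move=> nA nE; apply: (@squeeze_cvgr _ _ _ _ (fun=> 0) (fun n => d A n + d E n)).
- by near=> n; rewrite density_below_ge0 density_below_setU.
- exact: cvg_cst.
- by rewrite -[X in _ --> X]addr0; exact: cvgD.
Unshelve. all: by end_near. Qed.

Lemma null_set0 : null set0.
Proof.
by apply: cvg_near_cst; near=> n; rewrite density_below_set0.
Unshelve. all: by end_near. Qed.

Lemma null_set1 k : null [set k].
Proof.
apply: (@squeeze_cvgr _ _ _ _ (fun=> 0) (fun n => n%:R^-1)).
- by near=> n; rewrite density_below_ge0 density_below_set1.
- exact: cvg_cst.
- by rewrite -cvg_shiftS; exact: cvg_harmonic.
Unshelve. all: by end_near. Qed.

Lemma null_II N : null `I_N.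
Proof.
elim: N => [|N IH]; first by rewrite II0; exact: null_set0.
by rewrite IIS; apply: null_setU => //; exact: null_set1.
Qed.

Lemma null_eps A : (forall eps : R, 0 < eps ->
  \forall n \near \oo, d A n <= eps) -> null A.
Proof.
move=> Aeps; apply/cvgr0Pnorm_le => eps eps0.
by apply: filterS (Aeps eps eps0) => n; rewrite ger0_norm// density_below_ge0.
Qed.

Lemma null_or_conull A : D A -> null A \/ d A @ \oo --> (1 : R).
Proof. by case=> l; rewrite !inE => /orP[] /eqP ->; [left|right]. Qed.

(** Two sets of density 1 meet in a set of density 1, and 0 is the only other density in the
    algebra. By [null_mem] every other ultrafilter has a null member. *)
Definition stone_infty : stone D.
Proof.
exists [set A | d A @ \oo --> (1 : R)].
- by move=> A A1; exists 1 => //; rewrite !inE eqxx orbT.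
- apply: cvg_near_cst; near=> n; rewrite density_belowT//.
  by near: n; exact: nbhs_infty_gt.
- move=> s1; have e10 : (1 : R) = 0 := cvg_unique (@norm_hausdorff _ _) s1 null_set0.
  by have := oner_neq0 R; rewrite e10 eqxx.
- move=> A E A1 E1.
  apply: (@squeeze_cvgr _ _ _ _ (fun n => d A n + d E n - 1) (d A)) => //.
    near=> n; have n0 : (0 < n)%N by near: n; exact: nbhs_infty_gt.
    by rewrite density_belowI//= density_below_le// => x [].
  rewrite -[X in _ --> X](addrK (1 : R)); apply: cvgB; last exact: cvg_cst.
  exact: cvgD.
- move=> A E DE AE A1; have [nE|//] := null_or_conull DE.
  have e10 : (1 : R) = 0 := cvg_unique (@norm_hausdorff _ _) A1 (null_sub AE nE).
  by have := oner_neq0 R; rewrite e10 eqxx.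
- move=> A DA; have [nA|] := null_or_conull DA; last by left.
  right => /=; rewrite -[X in _ --> X]subr0.
  have : (fun n => 1 - d A n) @ \oo --> 1 - (0 : R) by apply: cvgB => //; exact: cvg_cst.
  apply: cvg_trans; apply: near_eq_cvg; near=> n; rewrite density_belowC//.
  by near: n; exact: nbhs_infty_gt.
Unshelve. all: by end_near. Defined.

Lemma null_mem p : p <> stone_infty -> exists2 A, p A & null A.
Proof.
move=> /stone_separate[A pA nA]; exists A => //.
by have [|//] := null_or_conull (uf_sub pA).
Qed.

(** The bound holds at every [n], not only in the limit, so that bounds for different sets can be
    added up uniformly in [n]. *)
Definition small (eps : R) p :=
  exists A, [/\ p A, null A & forall n, d A n <= eps].

Lemma principal_of_II p N : p `I_N -> exists2 k, (k < N)%N & p [set k].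
Proof.
elim: N => [|N IH]; first by rewrite II0 => /uf0.
rewrite IIS => /uf_setU[].
- exact/null_alg/null_II.
- exact/null_alg/null_set1.
- by move=> /IH[k kN pk]; exists k => //; rewrite ltnW.
- by exists N.
Qed.

(** A null member [A] of [p] has relative density above [eps] only at finitely many [n]. Either an
    initial segment can be cut off from [A], or [p] is principal at some [k]; then [[set k]] has
    relative density at most [n^-1] at [n > k] and 0 before, which is small once [K <= k]. *)
Lemma not_small_finite (eps : R) : 0 < eps -> finite_set [set p | ~ small eps p].
Proof.
move=> eps0.
have [K _ Keps] : \forall n \near \oo, (n%:R^-1 : R) < eps.
  have /cvgr0Pnorm_lt/(_ _ eps0) : (fun n => n%:R^-1 : R) @ \oo --> (0 : R).
    by rewrite -cvg_shiftS; exact: cvg_harmonic.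
  by apply: filterS => n; rewrite ger0_norm// invr_ge0.
apply: (@sub_finite_set _ _ (stone_infty |` (stone_principal D @` `I_K))); last first.
  by rewrite finite_setU; split=> //; apply: finite_image.
move=> p; apply: contra_notP => /not_orP[/null_mem[A pA nA] pK].
have [N _ NA] : \forall n \near \oo, d A n < eps.
  move/cvgr0Pnorm_lt/(_ _ eps0): nA.
  by apply: filterS => n; rewrite ger0_norm// density_below_ge0.
have DA := uf_sub pA.
have DI : D `I_N by exact/null_alg/null_II.
have [/principal_of_II[k kN pk]|pN] := uf_ultra p DI.
  exists [set k]; split=> //; first exact: null_set1.
  move=> n; have [kn|nk] := ltnP k n; last first.
    rewrite (le_trans _ (ltW eps0))// -(density_below_set0 n).
    by apply: density_below_leq => i ilt /= ik; move: ilt; rewrite ik ltnNge nk.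
  have [Kn|nK] := leqP K n; first by rewrite (le_trans (density_below_set1 _ _))// ltW// Keps.
  case: pK; exists k; first exact: ltn_trans nK.
  by rewrite -(stone_principalP pk).
exists (A `&` ~` `I_N); split; first exact: ufI.
  by apply: null_sub nA => x [].
move=> n; have [Nn|nN] := leqP N n.
  by rewrite (le_trans _ (ltW (NA _ Nn)))// density_below_le// => x [].
rewrite (le_trans _ (ltW eps0))// -(density_below_set0 n).
by apply: density_below_leq => i ilt /= [_]; apply; exact: ltn_trans nN.
Qed.

(** One step of a recursive choice: infinitely many points of [X] are left outside the clopen set of
    [A] for the later steps. *)
Lemma small_split (X : set (stone D)) (eps : R) : infinite_set X -> 0 < eps ->
  exists y A, [/\ X y, y A, null A, forall n, d A n <= eps &
    infinite_set (X `&` stone_clopen D (~` A))].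
Proof.
move=> Xinf eps0; have X'inf := infinite_setD Xinf (not_small_finite eps0).
set X' := X `\` _ in X'inf.
have [p X'p] := infinite_setN0 X'inf.
have [q [X'q /nesym pq]] := infinite_setN0 (infinite_setD X'inf (finite_set1 p)).
have [C pC qC] := stone_separate pq.
have DC := uf_sub pC.
(* One side of a clopen partition separating [p] from [q] contains infinitely many points; the point
   on the other side is taken. *)
suff take y E : X' y -> y E -> infinite_set (X' `&` stone_clopen D (~` E)) ->
    exists y A, [/\ X y, y A, null A, forall n, d A n <= eps &
      infinite_set (X `&` stone_clopen D (~` A))].
  have [XC|XC] := pselect (infinite_set (X' `&` stone_clopen D C)).
    by apply: (take q (~` C)) => //; [exact: uf_setC|rewrite setCK].
  apply: (take p C) => // XnC; apply: X'inf.
  rewrite -(setIT X') (_ : setT = stone_clopen D C `|` stone_clopen D (~` C)).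
    by rewrite setIUr finite_setU; split=> //; exact: contrapT.
  by apply/esym; rewrite -subTset => r _; exact: uf_ultra.
move=> [Xy /contrapT[A [yA nA Aeps]]] yE Einf.
exists y, (A `&` E); split=> //; first exact: ufI.
- by apply: null_sub nA => x [].
- by move=> n; rewrite (le_trans _ (Aeps n))// density_below_le// => x [].
apply: sub_infinite_set Einf => r [[Xr _] rE]; split=> //.
have AE : D (A `&` E) by apply: null_alg; apply: null_sub nA => x [].
apply: ufS rE => [|x Ex [_]//]; exact: algC.
Qed.

Lemma small_sequence (X : set (stone D)) (eps : nat -> R) : infinite_set X ->
  (forall n, 0 < eps n) ->
  exists y (A : nat -> set nat), [/\ forall n, X (y n), forall n, y n (A n), trivIset setT A,
    forall n, null (A n) & forall n m, d (A n) m <= eps n].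
Proof.
move=> Xinf eps0.
(* [V] stands for the union of the sets chosen so far. *)
pose inv V := null V /\ infinite_set (X `&` stone_clopen D (~` V)).
have /choice[f fP] : forall nV : nat * set nat, exists yA : stone D * set nat,
    inv nV.2 -> [/\ X yA.1, yA.1 yA.2, null yA.2, forall m, d yA.2 m <= eps nV.1 &
      yA.2 `&` nV.2 = set0 /\ inv (nV.2 `|` yA.2)].
  (* [(stone_infty, set0)] is a placeholder where the invariant fails. *)
  move=> [n V]; have [[nV Vinf]|] := pselect (inv V); last by exists (stone_infty, set0).
  have [y [A [[Xy yV] yA nA Aeps Ainf]]] := small_split Vinf (eps0 n).
  have nAV : null (A `\` V) by apply: null_sub nA => x [].
  exists (y, A `\` V) => _; split=> //=; first exact: ufI.
  - by move=> m; rewrite (le_trans _ (Aeps m))// density_below_le// => x [].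
  split; first by rewrite setDE -setIA setICl setI0.
  split; first exact: null_setU.
  have DVA : D (V `|` (A `\` V)) by apply/null_alg/null_setU.
  apply: sub_infinite_set Ainf => r [[Xr rV] rA]; split=> //.
  by apply: ufS (ufI rV rA) => [|x [Vx Ax] [//|[]//]]; exact: algC.
pose V := fix V n := if n is n'.+1 then V n' `|` (f (n', V n')).2 else set0.
have invV n : inv (V n).
  elim: n => [|n IH]; last by have [_ _ _ _ []] := fP (n, V n) IH.
  split; first exact: null_set0.
  by apply: sub_infinite_set Xinf => p Xp; split=> //; rewrite /= setC0; exact: ufT.
have AV m n : (m < n)%N -> (f (m, V m)).2 `<=` V n.
  elim: n => // n IH; rewrite ltnS leq_eqVlt => /predU1P[->|/IH mn] x Ax.
    by right.
  by left; exact: mn.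
exists (fun n => (f (n, V n)).1), (fun n => (f (n, V n)).2); split.
- by move=> n; have [] := fP (n, V n) (invV n).
- by move=> n; have [] := fP (n, V n) (invV n).
- apply/trivIsetP => i j _ _; wlog ij : i j / (i < j)%N => [H|_].
    rewrite neq_ltn => /orP[ij|ji]; first by apply: H => //; rewrite ltn_eqF.
    by rewrite setIC; apply: H => //; rewrite ltn_eqF.
  have [_ _ _ _ [jV _]] := fP (j, V j) (invV j).
  by rewrite -subset0 -jV => x [/(AV _ _ ij)].
- by move=> n; have [] := fP (n, V n) (invV n).
- by move=> n m; have [] := fP (n, V n) (invV n).
Qed.

(** The first [k] sets have a null union, and the later ones add at most [2 ^- k] to the relative
    density, uniformly in [m]. *)
Lemma null_bigcup (A : nat -> set nat) : (forall n, null (A n)) ->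
  (forall n m, d (A n) m <= 2 ^- n.+1) -> null (\bigcup_n A n).
Proof.
move=> nA Aeps; pose V n := \bigcup_(k in `I_n) A k.
have VS n : V n.+1 = V n `|` A n by rewrite /V IIS bigcup_setU bigcup_set1.
have nV n : null (V n).
  elim: n => [|n IH]; first by rewrite /V II0 bigcup_set0; exact: null_set0.
  by rewrite VS; exact: null_setU.
(* The sum of the bounds [2 ^- i.+1] for [i] from [k] up to [k + j] exclusive telescopes. *)
have Vle k j m : d (V (k + j)%N) m <= d (V k) m + (2 ^- k - 2 ^- (k + j)).
  elim: j => [|j IH]; first by rewrite addn0 subrr addr0.
  rewrite addnS VS (le_trans (density_below_setU _ _ _))//.
  have := Aeps (k + j)%N m; rewrite exprS invfM; move: IH.
  set a := d _ _; set b := d _ _; set c := d (A _) _.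
  by set u := 2 ^- (k + j); lra.
(* An element below [m] gives [A n] relative density at least [m^-1], which forces [2 ^ n.+1 <= m]
   and so [n < m]. *)
have UV m : d (\bigcup_n A n) m <= d (V m) m.
  apply: density_below_leq => i im [n _ Ai]; exists n => //=.
  rewrite ltnNge; apply/negP => mn.
  have := le_trans (density_below_ge im Ai) (Aeps n m).
  apply/negP; rewrite -ltNge ltf_pV2 ?posrE ?exprn_gt0 ?ltr0n//; last by case: m im {mn}.
  by rewrite -natrX ltr_nat (leq_ltn_trans mn)// (ltn_trans (ltnSn n))// ltn_expl.
apply: null_eps => eps eps0.
have [k _ keps] : \forall k \near \oo, (2 ^- k : R) < eps / 2.
  have e20 : 0 < eps / 2 by rewrite divr_gt0.
  have /cvgr0Pnorm_lt/(_ _ e20) : (fun k => (2^-1 : R) ^+ k) @ \oo --> (0 : R).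
    by apply: cvg_expr; rewrite ger0_norm ?invr_ge0// invf_lt1 ?ltr1n.
  by apply: filterS => n; rewrite exprVn ger0_norm// invr_ge0 exprn_ge0.
have e20 : 0 < eps / 2 by rewrite divr_gt0.
near=> m; have km : (k <= m)%N by near: m; exact: nbhs_infty_ge.
have Vk : d (V k) m < eps / 2.
  near: m; move/cvgr0Pnorm_lt/(_ _ e20): (nV k).
  by apply: filterS => n; rewrite ger0_norm// density_below_ge0.
have := Vle k (m - k)%N m; rewrite subnKC// => Vm.
have := UV m; have := keps k (leqnn k).
have : (0 : R) <= 2 ^- m by rewrite invr_ge0 exprn_ge0.
move: Vm Vk; set a := d _ _; set b := d _ _; set c := d (\bigcup_n _) _.
by set u := 2 ^- k; set v := 2 ^- m; lra.
Unshelve. all: by end_near. Qed.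

Lemma density_separated (X : set (stone D)) : infinite_set X ->
  exists y (A : nat -> set nat), (forall n, X (y n)) /\ separated_by y A.
Proof.
move=> Xinf; have [|y [A [Xy yA tA nA Aeps]]] :=
  small_sequence (eps := fun n => 2 ^- n.+1) Xinf.
  by move=> n; rewrite invr_gt0 exprn_gt0.
exists y, A; split=> //; split=> // E EA; apply: null_alg.
by apply: null_sub EA _; exact: null_bigcup.
Qed.

End Density.

(** * Averages and the construction of a JN-sequence *)

(** Terms of absolute value at most [eps / 2] contribute at most [eps / 2] to the average, the
    others at most [M] times the relative density of their indices. *)
Lemma average_cvg0 (R : realType) (g : nat -> R) (M : R) :
  (forall k, `|g k| <= M) ->
  (forall eps : R, 0 < eps -> null R [set k | eps < `|g k|]) ->
  (fun n => n%:R^-1 * \sum_(k < n) g k) @ \oo --> (0 : R).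
Proof.
move=> gM geps; apply/cvgr0Pnorm_le => eps eps0.
have M0 : 0 <= M by exact: le_trans (gM 0%N).
have e20 : 0 < eps / 2 by rewrite divr_gt0.
pose E := [set k | eps / 2 < `|g k|].
(* The divisor is [M + 1] because [M] may be 0. *)
have e2M : 0 < eps / 2 / (M + 1) by rewrite divr_gt0// ltr_pwDr.
near=> n.
have n0 : (0 < n)%N by near: n; exact: nbhs_infty_gt.
have dE : density_below R E n <= eps / 2 / (M + 1).
  near: n; move/cvgr0Pnorm_le/(_ _ e2M): (geps _ e20).
  by apply: filterS => n; rewrite ger0_norm// density_below_ge0.
have sumE : \sum_(k < n) `|g k| <= eps / 2 *+ n + M * #|[pred k : 'I_n | (k : nat) \in E]|%:R.
  rewrite -sum1_card natr_sum mulr_sumr [X in _ + X]big_mkcond /=.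
  have <- : \sum_(k < n) eps / 2 = eps / 2 *+ n by rewrite sumr_const card_ord.
  rewrite -big_split /=.
  apply: ler_sum => k _; rewrite mulr1 -topredE /=; case: ifPn => [_|].
    by rewrite (le_trans (gM k))// lerDr ltW.
  by rewrite addr0 notin_setE /= => /negP; rewrite -leNgt.
rewrite normrM ger0_norm ?invr_ge0//.
have nR : (0 : R) < n%:R by rewrite ltr0n.
rewrite mulrC ler_pdivrMr//.
rewrite (le_trans (ler_norm_sum _ _ _))// (le_trans sumE)//.
move: dE; rewrite /density_below ler_pdivrMr//.
set c := #|_|%:R => cn.
have : M * c <= (M + 1) * (eps / 2 / (M + 1) * n%:R).
  by rewrite ler_pM// lerDl.
have M1 : M + 1 != 0 by rewrite gt_eqF// ltr_pwDr.
rewrite mulrA [(M + 1) * _]mulrC divfK// => Mc.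
by rewrite -[eps / 2 *+ n]mulr_natr [in leRHS](splitr eps) mulrDl lerD2l.
Unshelve. all: by end_near. Qed.

Section DensityJN.
Variable R : realType.
Local Notation D := (density01_algebra R).
Local Notation pr := (stone_principal D).
Local Notation oo := (stone_infty R).

Lemma density01_set1 k : D [set k].
Proof. exact/null_alg/null_set1. Qed.

Lemma principal_inj : injective pr.
Proof.
move=> j k jk; have : pr k [set j] by rewrite -jk; split=> //; exact: density01_set1.
by case.
Qed.

Lemma principal_neq_infty k : pr k != oo.
Proof.
apply/eqP => /(congr1 (fun p : stone D => p [set k])) /= kE.
have : density_below R [set k] @ \oo --> (1 : R).
  by rewrite -kE; split=> //; exact: density01_set1.
move=> s1; have e10 : (1 : R) = 0 := cvg_unique (@norm_hausdorff _ _) s1 (null_set1 k).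
by have := oner_neq0 R; rewrite e10 eqxx.
Qed.

Definition avg_support n : {fset stone D} :=
  (oo |` [fset pr k | k in iota 0 n.+1])%fset.

(** Half the difference of the Dirac measure at [oo] and the average of those at the first [n.+1]
    principal points; the shift of the index avoids an empty average. *)
Definition avg_measure n : fs_measure R (stone D) :=
  [fsfun x in avg_support n => if x == oo then 2^-1 else - (2 * n.+1%:R)^-1 | 0].

(** A general [F] covers both the norm and the integral; [F 0 x = 0] lets the sum run over
    [avg_support n] instead of the support. *)
Lemma avg_measure_sum n (F : R -> stone D -> R) : (forall x, F 0 x = 0) ->
  \sum_(x <- finsupp (avg_measure n)) F (avg_measure n x) x =
  F 2^-1 oo + \sum_(k < n.+1) F (- (2 * n.+1%:R)^-1) (pr k).
Proof.
move=> F0; rewrite (big_fset_incl _ (finsupp_sub _ _ _)) => [|x _ xs]; last first.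
  by rewrite fsfun_dflt.
have oos : oo \notin [fset pr k | k in iota 0 n.+1]%fset.
  apply/negP => /imfsetP[k _ /eqP]; rewrite eq_sym.
  by rewrite (negbTE (principal_neq_infty k)).
rewrite /avg_support big_fsetU1//= {1}fsfunE /avg_support fset1U1 eqxx; congr (_ + _).
rewrite big_imfset; last by move=> j k _ _; exact: principal_inj.
rewrite (_ : enum_finmem _ = index_iota 0 n.+1); last first.
  exact: undup_id (iota_uniq 0 n.+1).
rewrite big_mkord; apply: eq_bigr => k _.
rewrite fsfunE ifT; last first.
  apply/fset1UP; right; apply/imfsetP; exists (k : nat) => //.
  exact: etrans (mem_iota 0 n.+1 k) (ltn_ord k).
by rewrite (negbTE (principal_neq_infty k)).
Qed.

Lemma avg_measure_JN : JN_sequence avg_measure.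
Proof.
split=> [n|f fc].
  rewrite /fs_norm (avg_measure_sum n (F := fun r _ => `|r|)); last by rewrite normr0.
  rewrite sumr_const card_ord normrN !ger0_norm ?invr_ge0 ?mulr_ge0//.
  by rewrite -[(_ * _)^-1 *+ _]mulr_natr invfM divfK ?pnatr_eq0// [RHS]splitr mul1r.
have fE n : fs_integral (avg_measure n) f =
    2^-1 * (n.+1%:R^-1 * \sum_(k < n.+1) (f oo - f (pr k))).
  rewrite /fs_integral (avg_measure_sum n (F := fun r x => r * f x)); last first.
    by move=> x; rewrite mul0r.
  rewrite -mulr_sumr sumrB sumr_const card_ord -[f oo *+ _]mulr_natr.
  have : n.+1%:R != 0 :> R by rewrite pnatr_eq0.
  by move: (n.+1%:R) (\sum_(_ < _) _) => c S c0; field.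
have [M fM] : exists M, forall q, `|f q| <= M.
  have /compact_bounded[M0 [_ M0P]] : compact (f @` [set: stone D] : set R^o).
    apply: continuous_compact; last exact: stone_compact.
    exact: continuous_subspaceT.
  by exists (M0 + 1) => q; apply: (M0P (M0 + 1)); [rewrite ltrDl|exists q].
suff lim : (fun n => n%:R^-1 * \sum_(k < n) (f oo - f (pr k))) @ \oo --> (0 : R).
  rewrite -cvg_shiftS in lim; have := cvgM (cvg_cst (2^-1 : R)) lim.
  rewrite mulr0 => lim2; under eq_fun do rewrite fE; exact: lim2.
apply: (@average_cvg0 R (fun k => f oo - f (pr k)) (M + M)) => [k|eps eps0].
  by rewrite (le_trans (ler_normB _ _))// lerD.
(* By continuity [f] is within [eps] of [f oo] on the clopen set of some [A] of density 1, so the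
   exceptional [k] lie in the null complement of [A]. *)
have /stone_nbhs[A [A1 Aeps]] : nbhs oo [set q | `|f oo - f q| < eps].
  by move/cvgrPdist_lt: (fc oo); apply.
have DA := uf_sub A1.
have nA : null R (~` A).
  have [//|nA1] := null_or_conull (algC DA).
  by have /uf_setCN := (nA1 : oo (~` A)).
apply: null_sub nA => k /= epsk Ak; move: epsk.
by rewrite ltNge ltW//; apply: Aeps.
Qed.

End DensityJN.

Theorem proposition6p2 (R : realType) :
  [/\ ~ (exists u : nat -> stone (density01_algebra R), nontrivial_convergent u),
      forall X : set (stone (density01_algebra R)), infinite_set X ->
        exists Y : set (stone (density01_algebra R)),
          [/\ Y `<=` X, infinite_set Y & homeomorphic (closure Y) beta_omega],
      exists mu : nat -> fs_measure R (stone (density01_algebra R)), JN_sequence mu &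
      forall mu : nat -> fs_measure R (stone (density01_algebra R)), JN_sequence mu ->
        (fun n => #|` finsupp (mu n)|) @ \oo --> \oo].
Proof.
split.
- move=> [u [[p up]]]; apply.
  have [uinf|/contrapT ufin] := pselect (infinite_set (range u)).
    have [y [A [uy yA]]] := density_separated uinf.
    by have := separated_not_cvg yA uy up.
  (* When the range is finite, its points other than [p] form a closed set, which [u] eventually
     avoids. *)
  exists p; have pu : nbhs p (~` (range u `\ p)).
    apply: open_nbhs_nbhs; split; last by move=> [_ /(_ erefl)].
    apply: closed_openC; apply: (accessible_finite_set_closed.1 _).
      exact/hausdorff_accessible/stone_hausdorff.
    exact: finite_setD.
  have {}pu : \forall n \near \oo, ~ (range u `\ p) (u n) by exact: up pu.
  apply: filterS pu => n un; apply: contrapT => unp.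
  by apply: un; split=> //; exists n.
- move=> X Xinf; have [y [A [Xy yA]]] := density_separated Xinf.
  exists (range y); split; first by move=> _ [n _ <-].
    exact/infinite_range/(separated_inj yA).
  exact: closure_separated_beta yA.
- by exists (@avg_measure R); exact: avg_measure_JN.
- move=> mu; apply: JN_support_unbounded; exact: density_separated.
Qed.
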